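(* There is a connected graph $F$ with $D_v(F)\le v(F)-3$. Specifically, $D_v(S_{4,4})=5$.
   Context: Graphs are finite simple graphs; $v(F)$ is the number of vertices of $F$. For a graph $F$, $\mathrm{Subgr}(F)$ is the class of all graphs containing a (not necessarily induced) subgraph isomorphic to $F$. We use first-order logic of graphs with relation symbols for adjacency and equality only. $D_v(F)$ is the minimum $d$ such that there exist a first-order sentence $\Phi$ of quantifier depth $d$ and an integer $k$ such that for every connected graph $G$ with at least $k$ vertices, $G\models\Phi$ if and only if $G$ contains a subgraph isomorphic to $F$. The sparkler graph $S_{a,b}$ is obtained from the star $K_{1,a-1}$ and the path $P_b$ on $b$ vertices by adding an edge between an end vertex of $P_b$ and the central vertex of $K_{1,a-1}$ (so $S_{4,4}$ has 8 vertices). *)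

(* Defs.v *)
From mathcomp Require Import all_boot.
Set Implicit Arguments. Unset Strict Implicit. Unset Printing Implicit Defensive.

Record graph := Graph {
  gV :> finType;
  adj : rel gV;
  adj_sym : symmetric adj;
  adj_irr : irreflexive adj }.

Definition nverts (G : graph) : nat := #|gV G|.

Definition connected (G : graph) : Prop :=
  0 < #|gV G| /\ forall x y : gV G, connect (@adj G) x y.

Definition contains (G F : graph) : Prop :=
  exists f : gV F -> gV G, injective f /\
    forall x y : gV F, adj x y -> adj (f x) (f y).

Inductive form : Type :=
  | FAdj : nat -> nat -> form
  | FEq  : nat -> nat -> form
  | FNot : form -> form
  | FAnd : form -> form -> form
  | FOr  : form -> form -> form
  | FEx  : nat -> form -> form
  | FAll : nat -> form -> form.

Fixpoint qdepth (phi : form) : nat :=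
  match phi with
  | FAdj _ _ | FEq _ _ => 0
  | FNot p => qdepth p
  | FAnd p q | FOr p q => maxn (qdepth p) (qdepth q)
  | FEx _ p | FAll _ p => (qdepth p).+1
  end.

Fixpoint fv (phi : form) : seq nat :=
  match phi with
  | FAdj i j | FEq i j => [:: i; j]
  | FNot p => fv p
  | FAnd p q | FOr p q => fv p ++ fv q
  | FEx n p | FAll n p => filter (fun m => m != n) (fv p)
  end.

Definition sentence (phi : form) : bool := nilp (fv phi).

Definition upd (T : Type) (v : nat -> T) (n : nat) (x : T) : nat -> T :=
  fun m => if m == n then x else v m.

Fixpoint holds (G : graph) (v : nat -> gV G) (phi : form) : bool :=
  match phi with
  | FAdj i j => adj (v i) (v j)
  | FEq i j => v i == v j
  | FNot p => ~~ holds v p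
  | FAnd p q => holds v p && holds v q
  | FOr p q => holds v p || holds v q
  | FEx n p => [exists x : gV G, holds (upd v n x) p]
  | FAll n p => [forall x : gV G, holds (upd v n x) p]
  end.

(* G |= phi (for a sentence, independent of the valuation). *)
Definition models (G : graph) (phi : form) : Prop :=
  forall v : nat -> gV G, holds v phi.

Definition Dv_definable (F : graph) (d : nat) : Prop :=
  exists (phi : form) (k : nat), sentence phi /\ qdepth phi <= d /\
    forall G : graph, connected G -> k <= nverts G ->
      (models G phi <-> contains G F).

Definition Dv_is (F : graph) (d : nat) : Prop :=
  Dv_definable F d /\ forall d', d' < d -> ~ Dv_definable F d'.

(* Sparkler S_{a,b} on vertex set 'I_(a+b): vertex 0 is the centre of the
   star K_{1,a-1} with leaves 1..a-1; vertices a..a+b-1 form the path P_b;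
   the centre 0 is joined to the path end a. *)
Definition sparkler_rel (a b : nat) : rel 'I_(a + b) :=
  fun x y =>
    let lo := minn x y in let hi := maxn x y in
    (x != y) &&
    [|| (lo == 0) && (hi < a),
        (a <= lo) && (hi == lo.+1)
      | (lo == 0) && (hi == a)].

Lemma sparkler_sym (a b : nat) : symmetric (@sparkler_rel a b).
Proof. by move=> x y; rewrite /sparkler_rel minnC maxnC eq_sym. Qed.

Lemma sparkler_irr (a b : nat) : irreflexive (@sparkler_rel a b).
Proof. by move=> x; rewrite /sparkler_rel eqxx. Qed.

Definition sparkler (a b : nat) : graph :=
  @Graph 'I_(a + b) (@sparkler_rel a b) (@sparkler_sym a b) (@sparkler_irr a b).

(* Main.v *)
Require Import Defs.
From mathcomp Require Import all_boot zify.
Set Implicit Arguments. Unset Strict Implicit. Unset Printing Implicit Defensive.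

(** Upper bound. If a connected graph [G] on at least 344 vertices has no S_{4,4}
    but has a vertex [v] of degree at least 4 starting a path with 4 edges, then
    all vertices are within distance 3 of [v], so some [w] within distance 2 of
    [v] has degree at least 7, and no path with 4 edges starts at [w].  A case
    analysis leaves one possibility: [v] has degree 4, is adjacent to [w], every
    such path reads [v a w c d] with [c], [d] not adjacent to [v], and the
    neighbours of [v] span a nonempty set of edges, all through [w].  Five
    quantifiers suffice to rule this configuration out, and every graph with an
    S_{4,4} has a vertex of degree at least 4 where it is ruled out.

    Lower bound. The joins of K_1 with many disjoint copies of K_4 and of K_3
    are equivalent in the 4-round Ehrenfeucht game, and only the first contains
    S_{4,4}. *)

(** * Connectedness of S_{4,4} *)

Local Notation S44 := (sparkler 4 4).

Lemma sparkler44_connected : connected S44.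
Proof.
split; first by rewrite card_ord.
have csym : connect_sym (@adj S44) by apply: sym_connect_sym; exact: adj_sym.
have step (i j : nat) (hi : i < 8) (hj : j < 8) :
    @sparkler_rel 4 4 (Ordinal hi) (Ordinal hj) ->
    connect (@adj S44) ord0 (Ordinal hi) -> connect (@adj S44) ord0 (Ordinal hj).
  by move=> e h; apply: connect_trans h (connect1 _).
have h0 (h : 0 < 8) : connect (@adj S44) ord0 (Ordinal h).
  by rewrite (_ : Ordinal h = ord0) ?connect0 //; apply: val_inj.
have h4 (h : 4 < 8) : connect (@adj S44) ord0 (Ordinal h) by apply: (step 0).
have h5 (h : 5 < 8) : connect (@adj S44) ord0 (Ordinal h) by apply: (step 4).
have h6 (h : 6 < 8) : connect (@adj S44) ord0 (Ordinal h) by apply: (step 5).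
have from0 (x : S44) : connect (@adj S44) ord0 x.
  case: x => -[|[|[|[|[|[|[|[|//]]]]]]]] h //; by [apply: (step 0) | apply: (step 6)].
by move=> x y; apply: connect_trans (from0 y); rewrite csym.
Qed.

(** * Paths with 4 edges and their extension to S_{4,4} *)

Section Paths.
Variable G : graph.
Implicit Types (u v w x y z a b c d : G).

Definition nbhd v : {set G} := [set x | adj v x].

Definition path5 v a b c d := uniq [:: v; a; b; c; d] && path (@adj G) v [:: a; b; c; d].

Lemma sparkler44P :
  contains G S44 <->
  exists v a b c d, path5 v a b c d /\
    exists x y z, uniq [:: v; x; y; z; a; b; c; d] && all (adj v) [:: x; y; z].
Proof.
split=> [[f [finj fadj]] | [v [a [b [c [d [vp [x [y [z /andP[u /= adjv]]]]]]]]]]].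
  pose g i (h : i < 8) := f (@Ordinal 8 i h).
  exists (@g 0 isT), (@g 4 isT), (@g 5 isT), (@g 6 isT), (@g 7 isT); split.
    by rewrite /path5 /= !inE !(inj_eq finj) !fadj.
  exists (@g 1 isT), (@g 2 isT), (@g 3 isT).
  by rewrite /= !inE !(inj_eq finj) !fadj.
case/andP: vp => _ /= pth.
(* Positions follow the numbering of [sparkler 4 4]: centre, leaves 1 to 3, path 4 to 7. *)
pose s := [:: v; x; y; z; a; b; c; d].
exists (fun i : 'I_8 => nth v s i); split.
  by move=> i j /eqP; rewrite nth_uniq // => /eqP/val_inj.
have [[h1 h2 h3] [h4 h5 h6 h7]] : [/\ adj v x, adj v y & adj v z] /\
    [/\ adj v a, adj a b, adj b c & adj c d].
  by case/and4P: adjv pth => ? ? ? _ /and5P[].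
case=> -[|[|[|[|[|[|[|[|//]]]]]]]] hi; case=> -[|[|[|[|[|[|[|[|//]]]]]]]] hj //=;
  by rewrite adj_sym.
Qed.

(** Three neighbours of [v] off the path become the leaves. *)
Lemma path5_sparkler44 v a b c d :
  path5 v a b c d -> 2 < #|nbhd v :\: [set a; b; c; d]| -> contains G S44.
Proof.
move=> vp /card_gt2P[x [y [z [[hx hy hz] [xy yz zx]]]]].
apply/sparkler44P; exists v, a, b, c, d; split => //; exists x, y, z.
move: hx hy hz; rewrite !inE !negb_or -!andbA.
move=> /and5P[xa xb xc xd vx] /and5P[ya yb yc yd vy] /and5P[za zb zc zd vz].
have nv t : adj v t -> v != t by move=> h; apply: contraTneq h => <-; rewrite adj_irr.
case/andP: vp => /= u _; move: u; rewrite !inE !negb_or -!andbA => u.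
rewrite vx vy vz (nv x) // (nv y) // (nv z) // xy yz (eq_sym x z) zx xa xb xc xd.
rewrite ya yb yc yd za zb zc zd /=.
by case/and5P: u => -> -> -> -> /and5P[-> -> -> -> /andP[-> ->]].
Qed.

(** At most four neighbours of [v] lie on the path, so three remain for the leaves. *)
Lemma path5_sparkler44_deg7 v a b c d :
  path5 v a b c d -> 6 < #|nbhd v| -> contains G S44.
Proof.
move=> vp dv; apply: (path5_sparkler44 vp).
rewrite cardsD; have: #|nbhd v :&: [set a; b; c; d]| <= 4.
  apply: leq_trans (subset_leq_card (subsetIr _ _)) _.
  by rewrite !cardsU !cards1; lia.
lia.
Qed.

(** Of the path vertices only [a] is a neighbour of [v], so at least three neighbours remain. *)
Lemma path5_sparkler44_far v a b c d :
  3 < #|nbhd v| -> path5 v a b c d -> ~~ adj v b -> ~~ adj v c -> ~~ adj v d ->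
  contains G S44.
Proof.
move=> dv vp vb vc vd; apply: (path5_sparkler44 vp).
rewrite (_ : _ :\: _ = nbhd v :\ a).
  have := cardsD1 a (nbhd v); case: (_ \in _); lia.
apply/setP=> x; rewrite !inE !negb_or -!andbA.
case vx: (adj v x); rewrite ?andbF // !andbT.
have ne t : ~~ adj v t -> x != t by apply: contraNneq => <-.
by rewrite (ne b) // (ne c) // (ne d) // !andbT.
Qed.

Lemma extra_nbr v a b c :
  3 < #|nbhd v| -> exists x, [/\ adj v x, x != a, x != b & x != c].
Proof.
move=> dv; have: 0 < #|nbhd v :\: [set a; b; c]|.
  rewrite cardsD subn_gt0; apply: leq_ltn_trans dv.
  apply: leq_trans (subset_leq_card (subsetIr _ _)) _.
  by rewrite !cardsU !cards1; lia.
by case/card_gt0P=> x; rewrite !inE !negb_or -!andbA => /and4P[? ? ? ?]; exists x.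
Qed.

Lemma adj_neq x y : adj x y -> x != y.
Proof. by move=> h; apply: contraTneq h => ->; rewrite adj_irr. Qed.

Lemma adj_nadj_neq v x y : adj v x -> ~~ adj v y -> x != y.
Proof. by move=> h; apply: contraNneq => <-. Qed.

Lemma path5I v a b c d :
  adj v a -> adj a b -> adj b c -> adj c d ->
  v != b -> v != c -> v != d -> a != c -> a != d -> b != d -> path5 v a b c d.
Proof.
move=> va ab bc cd h1 h2 h3 h4 h5 h6.
by rewrite /path5 /= !inE !negb_or !(adj_neq va, adj_neq ab, adj_neq bc, adj_neq cd) va ab bc cd h1 h2 h3 h4 h5 h6.
Qed.

Lemma path5E v a b c d : path5 v a b c d ->
  [/\ [/\ adj v a, adj a b, adj b c & adj c d],
      [/\ v != a, v != b, v != c & v != d], [/\ a != b, a != c & a != d],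
      b != c & b != d /\ c != d].
Proof.
rewrite /path5 /= !inE !negb_or -!andbA.
case/and5P=> -> -> -> -> /and5P[-> -> -> -> /and5P[-> -> _ -> /and4P[-> -> -> _]]].
by [].
Qed.

End Paths.

(** * Structure of graphs without S_{4,4} *)

Ltac by_path5 H a b c d :=
  case: (negP (H a b c d)); apply: path5I => //; by [rewrite adj_sym | rewrite eq_sym].
Section Soundness.
Variable G : graph.
Implicit Types (u v w x y z a b c d : G).
Hypothesis noS : ~ contains G S44.

(** Case analysis on the position of [w] on the path: unless [w] is [b], either some path with 4
    edges starts at [w] or [path5_sparkler44_far] applies. [by_path5] closes a goal by exhibiting
    the last four vertices of such a forbidden path. *)
Lemma path5_adj_hub v w a b c d :
  (forall x y z t, ~~ path5 w x y z t) -> 3 < #|nbhd v| -> adj v w ->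
  path5 v a b c d -> [/\ b = w, ~~ adj v c & ~~ adj v d].
Proof.
move=> now dv vw vp.
have wv : adj w v by rewrite adj_sym.
have := path5E vp => -[[va ab bc cd] [nva nvb nvc nvd] [nab nac nad] nbc [nbd ncd]].
have [wa|nwa] := eqVneq w a.
  subst a; case: noS; apply: (path5_sparkler44_far dv vp); apply/negP=> h.
  - by_path5 now v b c d.
  - have [x [vx xw xb xc]] := extra_nbr w b c dv.
    by_path5 now b c v x.
  - by_path5 now b c d v.
have [wb|nwb] := eqVneq w b.
  subst b; split=> //; apply/negP=> h.
  - by_path5 now a v c d.
  - have [x [vx xw xc xd]] := extra_nbr w c d dv.
    by_path5 now c d v x.
exfalso.
have [wc|nwc] := eqVneq w c.
  subst c; have [x [vx xw xa xb]] := extra_nbr w a b dv.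
  by_path5 now b a v x.
have [wd|nwd] := eqVneq w d.
  subst d; by_path5 now c b a v.
by_path5 now v a b c.
Qed.

(** A neighbour of [v] other than [u] can only be adjacent to [v] and [w]. Hence a path from [v]
    either forces one from [w], or its last three vertices are not adjacent to [v] and it extends to
    S_{4,4}. *)
Lemma path5_far_hub v u w a b c d :
  (forall x y z t, ~~ path5 w x y z t) -> 3 < #|nbhd v| ->
  adj v u -> adj u w -> ~~ adj v w -> v != w -> ~~ path5 v a b c d.
Proof.
move=> now dv vu uw nvw vw; apply/negP=> vp.
have uv : adj u v by rewrite adj_sym.
have wu : adj w u by rewrite adj_sym.
have nuv := adj_neq uv; have nuw := adj_neq uw.
(* Otherwise [w u x v y] is a path for a further neighbour [y] of [v]. *)
have nu x : adj v x -> x != u -> ~~ adj x u.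
  move=> vx xu; apply/negP=> h; have xw := adj_nadj_neq vx nvw.
  have [y [vy yu yx _]] := extra_nbr u x x dv; have yw := adj_nadj_neq vy nvw.
  by_path5 now u x v y.
(* Otherwise [w u v x y] is a path. *)
have nbr x y : adj v x -> x != u -> adj x y -> y = v \/ y = w.
  move=> vx xu xy; have xw := adj_nadj_neq vx nvw.
  have [->|yv] := eqVneq y v; first by left.
  have [->|yw] := eqVneq y w; first by right.
  have yu : y != u by apply: contraTneq xy => ->; apply: nu.
  by_path5 now u v x y.
have := path5E vp => -[[va ab bc cd] [nva nvb nvc nvd] [nab nac nad] nbc [nbd ncd]].
have [bw|nbw] := eqVneq b w; last first.
  have [au|nau] := eqVneq a u; last first.
    by case: (nbr a b) => // e; [rewrite e eqxx in nvb | rewrite e eqxx in nbw].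
  subst a.
  have nvb' : ~~ adj v b.
    apply/negP=> h; have := nu b h; rewrite eq_sym nab adj_sym ab; by move/(_ isT).
  have [cw|ncw] := eqVneq c w.
    subst c; have [x [vx xu xb xw]] := extra_nbr u b w dv.
    by_path5 now b u v x.
  have [dw|ndw] := eqVneq d w.
    by subst d; by_path5 now c b u v.
  by_path5 now u b c d.
(* The path is now [v a w c d]; it remains to refute an edge from [v] to [c] or to [d]. *)
subst b; apply: noS; apply: (path5_sparkler44_far dv vp) => //; apply/negP=> h.
  have [cu|ncu] := eqVneq c u.
    by subst c; by_path5 now a v u d.
  by case: (nbr c d) => // e; subst d; rewrite eqxx in nvd nbd.
have [du|ndu] := eqVneq d u.
  subst d; have [x [vx xu xc xw]] := extra_nbr u c w dv.
  by_path5 now c u v x.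
have dc : adj d c by rewrite adj_sym.
by case: (nbr d c) => // e; subst c; rewrite eqxx in nvc nbc.
Qed.

(** On the path only [a] and [w] are neighbours of [v], so a fifth neighbour would leave three
    leaves. Thus [x1] to [x4] are all the neighbours. They contain the edge [a w], and two disjoint
    edges among them would give a path from [w] passing through [v]. *)
Lemma path5_hub_nbrs v w a c d :
  (forall x y z t, ~~ path5 w x y z t) -> 3 < #|nbhd v| -> adj v w ->
  path5 v a w c d -> ~~ adj v c -> ~~ adj v d ->
  forall x1 x2 x3 x4 : G, uniq [:: x1; x2; x3; x4] ->
  all (adj v) [:: x1; x2; x3; x4] ->
  ~~ pairwise (fun x y => ~~ adj x y) [:: x1; x2; x3; x4] /\
  ~~ (adj x1 x2 && adj x3 x4).
Proof.
move=> now dv vw vp nvc' nvd' x1 x2 x3 x4 u vx.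
have := path5E vp => -[[va ab bc cd] [nva nvb nvc nvd] [nab nac nad] nbc [nbd ncd]].
have d4 : #|nbhd v| <= 4.
  rewrite leqNgt; apply/negP=> d5; apply: noS; apply: (path5_sparkler44 vp).
  have -> : nbhd v :\: [set a; w; c; d] = nbhd v :\: [set a; w].
    apply/setP=> x; rewrite !inE !negb_or -!andbA.
    case e: (adj v x); rewrite ?andbF // !andbT.
    have ne t : ~~ adj v t -> x != t by apply: contraNneq => <-.
    by rewrite (ne c) // (ne d) // !andbT.
  rewrite cardsD; have: #|nbhd v :&: [set a; w]| <= 2.
    by apply: leq_trans (subset_leq_card (subsetIr _ _)) _; rewrite cards2; case: (_ != _).
  by move: d5; clear; lia.
have nbhdE : nbhd v =i [:: x1; x2; x3; x4].
  have sub : [set x in [:: x1; x2; x3; x4]] \subset nbhd v.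
    by apply/subsetP=> x; rewrite !inE => h; apply: (allP vx); rewrite !inE.
  have /eqP <- : [set x in [:: x1; x2; x3; x4]] == nbhd v.
    rewrite eqEcard sub /=.
    have -> : #|[set x in [:: x1; x2; x3; x4]]| = 4 by rewrite cardsE; exact: card_uniqP u.
    by [].
  by move=> x; rewrite inE.
have hw : w \in [:: x1; x2; x3; x4] by rewrite -nbhdE inE.
have ha : a \in [:: x1; x2; x3; x4] by rewrite -nbhdE inE.
split.
  apply/negP => /= h; move: h; rewrite !andbT -!andbA => /and5P[h12 h13 h14 h23 /andP[h24 h34]].
  have ba : adj w a by rewrite adj_sym.
  move: hw ha; rewrite !inE => /or4P[]/eqP e1 /or4P[]/eqP e2; subst w a;
    by rewrite ?eqxx ?ab ?ba // in nab h12 h13 h14 h23 h24 h34.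
apply/negP=> /andP[h12 h34].
have h21 : adj x2 x1 by rewrite adj_sym.
have h43 : adj x4 x3 by rewrite adj_sym.
move: u; rewrite /= !inE !negb_or -!andbA => /and5P[n12 n13 n14 n23 /and3P[n24 n34 _]].
case/and5P: vx => vx1 vx2 vx3 vx4 _.
have := (adj_neq vx1, adj_neq vx2, adj_neq vx3, adj_neq vx4) => -[[[m1 m2] m3] m4].
move: hw; rewrite !inE => /or4P[]/eqP e; subst w.
- by_path5 now x2 v x3 x4.
- by_path5 now x1 v x3 x4.
- by_path5 now x4 v x1 x2.
- by_path5 now x3 v x1 x2.
Qed.

(** Iterated from [[set v]], this gives the balls around [v]. *)
Definition grow (A : {set G}) : {set G} := \bigcup_(x in A) (x |: nbhd x).

Lemma mem_grow (A : {set G}) y :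
  reflect (exists2 x, x \in A & (x == y) || adj x y) (y \in grow A).
Proof.
apply: (iffP bigcupP) => [] [x xA h]; exists x => //; move: h.
  by rewrite !inE eq_sym.
by rewrite !inE eq_sym.
Qed.

Lemma card_grow (A : {set G}) m :
  (forall x, x \in A -> #|nbhd x| <= m) -> #|grow A| <= #|A| * m.+1.
Proof.
move=> hA; rewrite /grow.
apply: (@leq_trans (\sum_(x in A) #|x |: nbhd x|)).
  elim/big_rec2: _ => [|x n B _ h]; first by rewrite cards0.
  by rewrite cardsU (leq_trans (leq_subr _ _)) // leq_add2l.
rewrite -sum_nat_const; apply: leq_sum => x xA.
by rewrite cardsU1 -add1n leq_add ?hA // leq_b1.
Qed.

(** A vertex [y] at distance 4 would end a path [v a b x y] with [b], [x], [y] not adjacent to [v],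
    giving S_{4,4}. So the ball of radius 3 is closed under adjacency. *)
Lemma ball3_full v : connected G -> 3 < #|nbhd v| ->
  grow (grow (grow [set v])) = [set: G].
Proof.
move=> [_ conn] dv; set B2 := grow (grow [set v]).
have clo x y : x \in grow B2 -> adj x y -> y \in grow B2.
  move=> xB xy; have [xB2|xB2] := boolP (x \in B2).
    by apply/mem_grow; exists x => //; rewrite xy orbT.
  apply/negPn/negP=> yB; case/mem_grow: xB => b bB /orP[/eqP e|bx].
    by rewrite -e bB in xB2.
  have up (A : {set G}) z : z \in A -> z \in grow A.
    by move=> h; apply/mem_grow; exists z; rewrite ?eqxx.
  have st (A : {set G}) z t : z \in A -> adj z t -> t \in grow A.
    by move=> h e; apply/mem_grow; exists z; rewrite ?e ?orbT.
  have B1b : b \notin grow [set v] by apply: contra xB2 => h; apply: (st _ b).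
  case/mem_grow: (bB) => a aB /orP[/eqP e|ab]; first by rewrite -e aB in B1b.
  have v0 : v \in [set v] by rewrite inE.
  have va : adj v a.
    case/mem_grow: (aB) => v'; rewrite inE => /eqP-> /orP[/eqP e|//].
    by case/negP: B1b; apply: (st _ v); rewrite // e.
  have n2 t : t \notin B2 -> ~~ adj v t /\ v != t.
    move=> h; split; first by apply: contra h => h; apply/up/(st _ v).
    by apply: contraNneq h => <-; apply/up/up.
  have nb : ~~ adj v b by apply: contra B1b; apply: st.
  have yB2 : y \notin B2 by apply: contra yB; apply: up.
  have [[vx nvx] [vy nvy]] := (n2 _ xB2, n2 _ yB2).
  apply: noS; apply: (@path5_sparkler44_far _ v a b x y) => //.
  apply: path5I => //.
  - by apply: contraNneq B1b => <-; apply: up.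
  - by apply: adj_nadj_neq va vx.
  - by apply: adj_nadj_neq va vy.
  - by apply: contraNneq yB2 => <-.
apply/setP=> y; rewrite !inE.
have/connectP[p] := conn v y; have: v \in grow B2.
  by do 3!(apply/mem_grow; exists v; rewrite ?eqxx //); rewrite inE.
move: {dv} (grow B2) clo => B clo.
elim: p v {B2} => [|z p IH] x xB /=; first by move=> _ ->.
by case/andP=> xz pth; apply: IH pth; apply: clo xz.
Qed.

(** If all degrees within distance 2 of [v] were at most 6, each of the three [grow] steps would
    multiply the size by at most 7, leaving at most 7^3 = 343 vertices. The degree bound on [v]
    makes [w] differ from [v]. *)
Lemma hub_exists v : connected G -> 343 < #|G| -> 3 < #|nbhd v| -> #|nbhd v| <= 6 ->
  exists w, [/\ 6 < #|nbhd w|, v != w & adj v w \/ exists2 u, adj v u & adj u w].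
Proof.
move=> conn big dv dv6.
have [/existsP[w /andP[wB dw]]|] :=
    boolP [exists w, (w \in grow (grow [set v])) && (6 < #|nbhd w|)].
  have vw : v != w by apply: contraTneq dw => <-; rewrite -leqNgt.
  exists w; split=> //.
  case/mem_grow: wB => u /mem_grow[v']; rewrite inE => /eqP->.
  case/orP=> [/eqP<-|vu].
    by case/orP=> [/eqP e|]; [rewrite e eqxx in vw | left].
  by case/orP=> [/eqP<-|uw]; [left | right; exists u].
move=> /existsPn small; exfalso; move: big.
have up (A : {set G}) : A \subset grow A.
  by apply/subsetP=> z h; apply/mem_grow; exists z; rewrite ?eqxx.
have sm (A : {set G}) : A \subset grow (grow [set v]) -> #|grow A| <= #|A| * 7.
  move=> sA; apply: card_grow => x xA; have := small x.
  by rewrite (subsetP sA) //= -leqNgt.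
have h1 := sm [set v] (subset_trans (up _) (up _)).
have h2 := sm (grow [set v]) (up _).
have h3 := sm _ (subxx _).
by rewrite -cardsT -(ball3_full conn dv); move: h1 h2 h3; rewrite cards1; clear; lia.
Qed.

Lemma path5_structure v a b c d :
  connected G -> 343 < #|G| -> 3 < #|nbhd v| -> path5 v a b c d ->
  [/\ adj v b, ~~ adj v c, ~~ adj v d &
  forall x1 x2 x3 x4 : G, uniq [:: x1; x2; x3; x4] ->
  all (adj v) [:: x1; x2; x3; x4] ->
  ~~ pairwise (fun x y => ~~ adj x y) [:: x1; x2; x3; x4] /\
  ~~ (adj x1 x2 && adj x3 x4)].
Proof.
move=> conn big dv vp.
have no7 w : 6 < #|nbhd w| -> forall x y z t, ~~ path5 w x y z t.
  by move=> dw x y z t; apply/negP=> h; apply: noS; apply: path5_sparkler44_deg7 h dw.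
have [w [dw vw h]] : exists w, [/\ 6 < #|nbhd w|, v != w & adj v w \/ exists2 u, adj v u & adj u w].
  (* As [v] starts a path, its degree is at most 6. *)
  apply: hub_exists => //; rewrite leqNgt; apply/negP=> /no7/(_ a b c d).
  by rewrite vp.
have now := no7 w dw.
have [vw'|nvw] := boolP (adj v w); last first.
  case: h => [h|[u vu uw]]; first by rewrite h in nvw.
  by have := path5_far_hub a b c d now dv vu uw nvw vw; rewrite vp.
have [e nc nd] := path5_adj_hub now dv vw' vp; subst b.
by split=> //; apply: path5_hub_nbrs vp _ _.
Qed.

End Soundness.

(** * Configurations forced by a copy of S_{4,4} *)

Lemma containsP (G F : graph) : reflect (contains G F)
  [exists f : {ffun F -> G}, injectiveb f &&
    [forall x, forall y, adj x y ==> adj (f x) (f y)]].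
Proof.
apply: (iffP existsP) => [[f /andP[/injectiveP finj /forallP fadj]]|[f [finj fadj]]].
  by exists f; split=> // x y; move/forallP/(_ y)/implyP: (fadj x).
exists [ffun x => f x]; apply/andP; split.
  by apply/injectiveP=> x y; rewrite !ffunE => /finj.
by apply/forallP=> x; apply/forallP=> y; apply/implyP=> xy; rewrite !ffunE fadj.
Qed.

(** The centre of the copy serves as [v]. If its path has the exceptional shape, [a] and [b] are
    adjacent neighbours of [v], and the edges among [a], [b] and the leaves yield another path or a
    suitable quadruple. *)
Lemma sparkler44_cases (G : graph) : contains G S44 ->
  exists v : G, 3 < #|nbhd v| /\ exists a b c d, path5 v a b c d /\
  (~~ (adj v b && ~~ adj v c && ~~ adj v d) \/
   exists x1 x2 x3 x4 : G, [/\ uniq [:: x1; x2; x3; x4], all (adj v) [:: x1; x2; x3; x4] &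
     pairwise (fun x y => ~~ adj x y) [:: x1; x2; x3; x4] || (adj x1 x2 && adj x3 x4)]).
Proof.
case/sparkler44P=> v [a [b [c [d [vp [x [y [z /andP[u vxyz]]]]]]]]]; exists v.
have := path5E vp => -[[va ab bc cd] [nva nvb nvc nvd] [nab nac nad] nbc [nbd ncd]].
have /and4P[vx vy vz _] := vxyz.
have ua : uniq [:: x; y; z; a] := mask_uniq u [:: false; true; true; true; true].
have va4 : all (adj v) [:: x; y; z; a] by rewrite /= va vx vy vz.
split.
  have <- : size [:: x; y; z; a] = 4 by [].
  rewrite -(card_uniqP ua); apply: subset_leq_card; apply/subsetP=> t ht.
  by rewrite inE (allP va4).
have [h|] := boolP (~~ (adj v b && ~~ adj v c && ~~ adj v d)).
  by exists a, b, c, d; split=> //; left.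
rewrite negbK => /andP[/andP[vb nvc'] nvd'].
(* Such a [t] gives the path [v t a b c], whose fourth vertex [b] is adjacent to [v]. *)
have [/existsP[t /andP[/andP[vt tb] ta]]|/existsPn na] :=
    boolP [exists t : G, (adj v t && (t != b)) && adj t a].
  exists t, a, b, c; split; last by left; rewrite va vb.
  by apply: path5I => //; apply: adj_nadj_neq vt nvc'.
exists a, b, c, d; split=> //; right.
(* No leaf is adjacent to [a]. An edge between leaves is disjoint from [a b]; without one, the
   leaves and [a] are independent. *)
have [xa ya za] : [/\ ~~ adj x a, ~~ adj y a & ~~ adj z a].
  have nadj t : adj v t -> uniq [:: t; b] -> ~~ adj t a.
    by move=> vt; rewrite /= inE andbT => tb; have := na t; rewrite vt tb.
  split; apply: nadj => //.
  - exact: mask_uniq u [:: false; true; false; false; false; true].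
  - exact: mask_uniq u [:: false; false; true; false; false; true].
  - exact: mask_uniq u [:: false; false; false; true; false; true].
have [xy|nxy] := boolP (adj x y).
  exists x, y, a, b; split; last by rewrite xy ab orbT.
    exact: mask_uniq u [:: false; true; true; false; true; true].
  by rewrite /= vx vy va vb.
have [xz|nxz] := boolP (adj x z).
  exists x, z, a, b; split; last by rewrite xz ab orbT.
    exact: mask_uniq u [:: false; true; false; true; true; true].
  by rewrite /= vx vz va vb.
have [yz|nyz] := boolP (adj y z).
  exists y, z, a, b; split; last by rewrite yz ab orbT.
    exact: mask_uniq u [:: false; false; true; true; true; true].
  by rewrite /= vy vz va vb.
by exists x, y, z, a; split=> //=; rewrite nxy nxz nyz xa ya za.
Qed.

(** * The sentence of depth 5 and its meaning *)

Definition FEx4 phi := FEx 1 (FEx 2 (FEx 3 (FEx 4 phi))).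

(** [FEq 0 0] plays the role of truth; variable 0 is bound by the outermost quantifier of
    [Fsparkler44], which therefore stays closed. *)
Definition FAnds := foldr FAnd (FEq 0 0).

Definition FDistinct (s : seq (nat * nat)) := FAnds [seq FNot (FEq p.1 p.2) | p <- s].

Definition FAdjs (s : seq (nat * nat)) := FAnds [seq FAdj p.1 p.2 | p <- s].

Definition F4nbrs := FAnd
  (FDistinct [:: (1, 2); (1, 3); (1, 4); (2, 3); (2, 4); (3, 4)])
  (FAdjs [:: (0, 1); (0, 2); (0, 3); (0, 4)]).

Definition Fpath5 := FAnd
  (FDistinct [:: (0, 1); (0, 2); (0, 3); (0, 4);
                 (1, 2); (1, 3); (1, 4); (2, 3); (2, 4); (3, 4)])
  (FAdjs [:: (0, 1); (1, 2); (2, 3); (3, 4)]).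

Definition Fspread := FOr
  (FAnds [seq FNot (FAdj p.1 p.2) | p <- [:: (1, 2); (1, 3); (1, 4); (2, 3); (2, 4); (3, 4)]])
  (FAnd (FAdj 1 2) (FAdj 3 4)).

(** Variable 0 is the centre [v]. The two conjuncts of each alternative rebind variables 1 to 4,
    once for neighbours of [v] and once for the path, which keeps the depth at 5. *)
Definition Fsparkler44 := FEx 0 (FOr
  (FAnd (FEx4 F4nbrs)
     (FEx4 (FAnd Fpath5 (FNot (FAnd (FAnd (FAdj 0 2) (FNot (FAdj 0 3))) (FNot (FAdj 0 4)))))))
  (FAnd (FEx4 (FAnd F4nbrs Fspread)) (FEx4 Fpath5))).

Section Semantics.
Variable G : graph.
Implicit Types (s : nat -> G) (v a b c d : G).

Lemma holds_and s p q : holds s (FAnd p q) = holds s p && holds s q.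
Proof. by []. Qed.

Lemma holds_or s p q : holds s (FOr p q) = holds s p || holds s q.
Proof. by []. Qed.

Lemma FExP s n p : reflect (exists x, holds (upd s n x) p) (holds s (FEx n p)).
Proof. exact: existsP. Qed.

Lemma FEx4P s phi : reflect
  (exists a b c d : G, holds (upd (upd (upd (upd s 1 a) 2 b) 3 c) 4 d) phi)
  (holds s (FEx4 phi)).
Proof.
apply: (iffP existsP) => [[a /existsP[b /existsP[c /existsP[d h]]]]|[a [b [c [d h]]]]].
  by exists a, b, c, d.
by exists a; apply/existsP; exists b; apply/existsP; exists c; apply/existsP; exists d.
Qed.

Lemma holds_path5 s v a b c d :
  holds (upd (upd (upd (upd (upd s 0 v) 1 a) 2 b) 3 c) 4 d) Fpath5 = path5 v a b c d.
Proof. by rewrite /path5 /= /upd /= !inE !negb_or eqxx !andbT -!andbA. Qed.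

Lemma holds_4nbrs s v a b c d :
  holds (upd (upd (upd (upd (upd s 0 v) 1 a) 2 b) 3 c) 4 d) F4nbrs =
  uniq [:: a; b; c; d] && all (adj v) [:: a; b; c; d].
Proof. by rewrite /= /upd /= !inE !negb_or eqxx !andbT -!andbA. Qed.

Lemma holds_spread s v a b c d :
  holds (upd (upd (upd (upd (upd s 0 v) 1 a) 2 b) 3 c) 4 d) Fspread =
  pairwise (fun x y => ~~ adj x y) [:: a; b; c; d] || (adj a b && adj c d).
Proof. by rewrite /= /upd /= eqxx !andbT -!andbA. Qed.

Lemma deg4P v : reflect
  (exists a b c d : G, uniq [:: a; b; c; d] && all (adj v) [:: a; b; c; d])
  (3 < #|nbhd v|).
Proof.
apply: (iffP idP) => [dv|[a [b [c [d /andP[u vs]]]]]]; last first.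
  have <- : size [:: a; b; c; d] = 4 by [].
  rewrite -(card_uniqP u); apply: subset_leq_card; apply/subsetP=> t ht.
  by rewrite inE (allP vs).
have /card_gt2P[a [b [c [[ha hb hc] [nab nbc nca]]]]] := ltnW dv.
have [d [vd da db dc]] := extra_nbr a b c dv.
exists a, b, c, d; move: ha hb hc; rewrite !inE => va vb vc.
by rewrite /= !inE !negb_or va vb vc vd nab nbc (eq_sym a c) nca !(eq_sym _ d) da db dc.
Qed.

Lemma holds_sparkler44 s : connected G -> 343 < #|G| ->
  (holds s Fsparkler44 <-> contains G S44).
Proof.
move=> conn big; split.
  (* Containment is decidable, so S_{4,4} may be assumed absent and [path5_structure] contradicts
     either alternative. *)
  case/FExP=> v h; apply/containsP; apply: contraT => /(elimN (containsP _ _)) noS.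
  move: h; rewrite holds_or 2!holds_and => /orP[]/andP[/FEx4P[x1 [x2 [x3 [x4 hx]]]] /FEx4P[a [b [c [d hp]]]]].
    have dv : 3 < #|nbhd v| by apply/deg4P; exists x1, x2, x3, x4; rewrite -(holds_4nbrs s).
    move: hp; rewrite holds_and holds_path5 => /andP[vp].
    by have [vb vc vd _] := path5_structure noS conn big dv vp; rewrite /= /upd /= vb vc vd.
  move: hx hp; rewrite holds_and holds_4nbrs holds_spread holds_path5 => /andP[xs sp] vp.
  have dv : 3 < #|nbhd v| by apply/deg4P; exists x1, x2, x3, x4.
  have [_ _ _] := path5_structure noS conn big dv vp.
  case/andP: xs => u vx /(_ _ _ _ _ u vx)[] /negPf h1 /negPf h2.
  by rewrite h1 h2 in sp.
case/sparkler44_cases=> v [dv [a [b [c [d [vp h]]]]]].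
apply/FExP; exists v; rewrite holds_or 2!holds_and; apply/orP; case: h => [h|[x1 [x2 [x3 [x4 [u vx sp]]]]]].
  left; apply/andP; split; apply/FEx4P.
    have /deg4P[x1 [x2 [x3 [x4 hx]]]] := dv.
    by exists x1, x2, x3, x4; rewrite holds_4nbrs.
  by exists a, b, c, d; rewrite holds_and holds_path5 vp.
right; apply/andP; split; apply/FEx4P.
  by exists x1, x2, x3, x4; rewrite holds_and holds_4nbrs holds_spread u vx.
by exists a, b, c, d; rewrite holds_path5.
Qed.

End Semantics.

Lemma sparkler44_definable : Dv_definable S44 5.
Proof.
exists Fsparkler44, 344; split=> //; split=> // G conn big.
have E s := holds_sparkler44 s conn big.
(* A vertex is needed to have a valuation at which to use [models]. *)
case: (conn) => /card_gt0P[x0 _] _.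
by split=> [/(_ (fun=> x0))/E|h s]; last apply/E.
Qed.

(** * Ehrenfeucht games *)

Section Game.
Variables G H : graph.
Implicit Types ps : seq (G * H).

Definition partial_iso ps := forall p q, p \in ps -> q \in ps ->
  (p.1 == q.1) = (p.2 == q.2) /\ adj p.1 q.1 = adj p.2 q.2.

Fixpoint duplicator_wins r ps : Prop :=
  if r is r'.+1 then
    (forall x : G, exists y : H, duplicator_wins r' ((x, y) :: ps)) /\
    (forall y : H, exists x : G, duplicator_wins r' ((x, y) :: ps))
  else partial_iso ps.

Lemma partial_iso_cons p ps : partial_iso (p :: ps) -> partial_iso ps.
Proof. by move=> h q q' hq hq'; apply: h; rewrite inE ?hq ?hq' orbT. Qed.

(** As [H] is nonempty the remaining rounds can be played out, and dropping pairs preserves partial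
    isomorphisms. *)
Lemma duplicator_wins_iso r ps : 0 < #|H| -> duplicator_wins r ps -> partial_iso ps.
Proof.
move=> /card_gt0P[y _]; elim: r ps => [//|r IH] ps /= [_ /(_ y)[x /IH]].
exact: partial_iso_cons.
Qed.

(** Induction on the formula, each quantifier costing one round. The pair of a rebound variable
    stays in [ps], so valuations only have to select pairs from [ps]. *)
Lemma duplicator_wins_holds r ps (phi : form) (s : nat -> G) (t : nat -> H) :
  0 < #|H| -> duplicator_wins r ps -> qdepth phi <= r ->
  {in fv phi, forall n, (s n, t n) \in ps} -> holds s phi = holds t phi.
Proof.
move=> H0; elim: phi r ps s t => [i j|i j|p IH|p IHp q IHq|p IHp q IHq|n p IH|n p IH]
    r ps s t win /=.
- move=> _ sub; have iso := duplicator_wins_iso H0 win.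
  by have [] := iso (s i, t i) (s j, t j); rewrite ?sub // !inE eqxx ?orbT.
- move=> _ sub; have iso := duplicator_wins_iso H0 win.
  by have [] := iso (s i, t i) (s j, t j); rewrite ?sub // !inE eqxx ?orbT.
- by move=> d sub; rewrite (IH r ps s t).
- rewrite geq_max => /andP[dp dq] sub.
  by rewrite (IHp r ps s t) // ?(IHq r ps s t) // => m hm; apply: sub; rewrite mem_cat hm ?orbT.
- rewrite geq_max => /andP[dp dq] sub.
  by rewrite (IHp r ps s t) // ?(IHq r ps s t) // => m hm; apply: sub; rewrite mem_cat hm ?orbT.
- case: r win => // r [forth back] d sub.
  have ext x y : {in fv p, forall m, (upd s n x m, upd t n y m) \in (x, y) :: ps}.
    move=> m hm; rewrite /upd; have [_|nm] := eqVneq m n; first by rewrite mem_head.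
    by rewrite inE sub ?orbT // mem_filter nm.
  apply/existsP/existsP => [[x hx]|[y hy]].
    have [y w] := forth x; exists y.
    by rewrite -(IH _ _ _ _ w d (ext x y)).
  have [x w] := back y; exists x.
  by rewrite (IH _ _ _ _ w d (ext x y)).
- case: r win => // r [forth back] d sub.
  have ext x y : {in fv p, forall m, (upd s n x m, upd t n y m) \in (x, y) :: ps}.
    move=> m hm; rewrite /upd; have [_|nm] := eqVneq m n; first by rewrite mem_head.
    by rewrite inE sub ?orbT // mem_filter nm.
  apply/forallP/forallP => [hs y|ht x].
    have [x w] := back y.
    by rewrite -(IH _ _ _ _ w d (ext x y)).
  have [y w] := forth x.
  by rewrite (IH _ _ _ _ w d (ext x y)).
Qed.

End Game.

(** * Windmill graphs *)

Definition windmill_rel (n m : nat) : rel (option ('I_n * 'I_m)) :=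
  fun x y => if x is Some p then if y is Some q then (p.1 == q.1) && (p.2 != q.2) else true
             else y != None.

Lemma windmill_sym n m : symmetric (@windmill_rel n m).
Proof. by case=> [p|] [q|] //=; rewrite (eq_sym p.1) (eq_sym p.2). Qed.

Lemma windmill_irr n m : irreflexive (@windmill_rel n m).
Proof. by case=> [p|] //=; rewrite !eqxx. Qed.

(** The join of K_1 with [n] disjoint copies of K_m: [None] is the hub, [Some (i, k)] is vertex [k]
    of copy [i]. *)
Definition windmill (n m : nat) : graph := Graph (@windmill_sym n m) (@windmill_irr n m).

Definition is_hub n m (x : windmill n m) : bool := ~~ isSome x.

Lemma windmill_connected n m : connected (windmill n m).
Proof.
split; first by apply/card_gt0P; exists None.
have csym : connect_sym (@adj (windmill n m)) by apply: sym_connect_sym; exact: adj_sym.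
have hub (x : windmill n m) : connect (@adj (windmill n m)) None x.
  by case: x => [p|]; [apply: connect1 | apply: connect0].
by move=> x y; apply: connect_trans (hub y); rewrite csym.
Qed.

Lemma windmill_nverts n m : nverts (windmill n m) = (n * m).+1.
Proof. by rewrite /nverts /= card_option card_prod !card_ord. Qed.

(** The hub is the centre, copy 0 carries the path, and copies 1, 2, 3 provide one leaf each. *)
Lemma windmill4_contains n : 3 < n -> contains (windmill n 4) S44.
Proof.
move=> n4; apply/sparkler44P.
pose p k (hk : k < 4) : windmill n 4 := Some (Ordinal (ltn_trans (isT : 0 < 3) n4), Ordinal hk).
pose l k (hk : k < 4) : windmill n 4 := Some (Ordinal (leq_trans hk n4), Ordinal (isT : 0 < 4)).
exists None, (p 0 isT), (p 1 isT), (p 2 isT), (p 3 isT); split=> //.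
by exists (l 1 isT), (l 2 isT), (l 3 isT).
Qed.

(** A centre other than the hub has degree only 3; from the hub, the other four path vertices would
    have to lie in a single triangle. *)
Lemma windmill3_not_contains n : ~ contains (windmill n 3) S44.
Proof.
case/sparkler44P=> v [a [b [c [d [vp [x [y [z /andP[u vxyz]]]]]]]]].
have := path5E vp => -[[va ab bc cd] [nva nvb nvc nvd] [nab nac nad] nbc [nbd ncd]].
case: v nva nvb nvc nvd va vp u vxyz => [[i k]|] nva nvb nvc nvd va vp u vxyz.
  have sub : {subset [:: Some (i, k); x; y; z; a] <= None :: [seq Some (i, j) | j : 'I_3]}.
    move=> t; rewrite !inE.
    have key t' : @windmill_rel n 3 (Some (i, k)) t' ->
        (t' == None) || (t' \in [seq Some (i, j) | j : 'I_3]).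
      case: t' => [[i' j]|] //= /andP[/eqP<- _]; apply/mapP; exists j => //.
      by rewrite mem_enum.
    case/and4P: vxyz => vx vy vz _.
    case/or4P=> [/eqP->|/eqP->|/eqP->|/orP[]/eqP->]; try exact: key.
    by rewrite map_f ?mem_enum ?orbT.
  have u5 : uniq [:: Some (i, k); x; y; z; a] := mask_uniq u [:: true; true; true; true; true].
  by have := uniq_leq_size u5 sub; rewrite /= size_map -cardE card_ord.
case: a b c d nva nvb nvc nvd ab bc cd vp nab nac nad nbc nbd ncd {va u} =>
  [[i1 k1]|] [[i2 k2]|] [[i3 k3]|] [[i4 k4]|] //= _ _ _ _.
move=> /andP[/eqP e1 _] /andP[/eqP e2 _] /andP[/eqP e3 _] _; subst i2 i3 i4.
move=> n12 n13 n14 n23 n24 n34.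
have u4 : uniq [:: k1; k2; k3; k4].
  have inj : injective (fun k : 'I_3 => Some (i1, k)) by move=> k k' [].
  rewrite -(map_inj_uniq inj) /= !inE !negb_or.
  by rewrite n12 n13 n14 n23 n24 n34.
by have := max_card (mem [:: k1; k2; k3; k4]); rewrite (card_uniqP u4) card_ord.
Qed.

(** * Duplicator's strategy on two windmills *)

Section Windmills.
Arguments adj : simpl never.
Variables n m1 m2 : nat.
Hypotheses (n4 : 3 < n) (m2_ge3 : 2 < m2).
Local Notation G := (windmill n m1).
Local Notation H := (windmill n m2).

Definition hub_iso (ps : seq (G * H)) :=
  partial_iso ps /\ {in ps, forall p, is_hub p.1 = is_hub p.2}.

(* The last move is the only one that may break [hub_iso]: a fourth vertex of a
   4-clique is answered by the hub. *)
Lemma windmill_forth (ps : seq (G * H)) (x : G) : size ps <= 3 -> hub_iso ps ->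
  exists y : H, partial_iso ((x, y) :: ps) /\
    (size ps <= 2 -> hub_iso ((x, y) :: ps)).
Proof.
move=> sz [iso hub].
have consI y : {in ps, forall p, (p.1 == x) = (p.2 == y) /\ adj p.1 x = adj p.2 y} ->
    partial_iso ((x, y) :: ps).
  move=> h p q; rewrite !inE => /predU1P[->|hp] /predU1P[->|hq].
  - by rewrite !eqxx !adj_irr.
  - by have [h1 h2] := h q hq; split; [rewrite eq_sym h1 eq_sym | rewrite adj_sym h2 adj_sym].
  - exact: h.
  - exact: iso.
have strictI y : is_hub x = is_hub y ->
    {in ps, forall p, (p.1 == x) = (p.2 == y) /\ adj p.1 x = adj p.2 y} ->
    partial_iso ((x, y) :: ps) /\ (size ps <= 2 -> hub_iso ((x, y) :: ps)).
  move=> e /consI h; split=> // _; split=> // p; rewrite inE => /predU1P[->|] //.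
  exact: hub.
have [/hasP[p hp /eqP e]|/hasPn new] := boolP (has (fun p => p.1 == x) ps).
  by subst x; exists p.2; apply: strictI => [|q hq]; [apply: hub | apply: iso].
case: x consI strictI new => [[i k]|] consI strictI new; last first.
  exists None; apply: strictI => // -[p q] hp; have := hub _ hp.
  by case: p q {hp} => [?|] [?|].
have adjE (M : nat) (z : windmill n M) i' k' : z != Some (i', k') ->
    adj z (Some (i', k')) = if z is Some q then q.1 == i' else true.
  rewrite /adj; case: z => [[i2 k2]|] //= ne; have [e|//] := eqVneq i2 i'; subst i2.
  by apply: contraNneq ne => ->.
have [/hasP[[p0 q0] hp0 cl0]|/hasPn newcl] :=
    boolP (has (fun p : G * H => if p.1 is Some q then q.1 == i else false) ps); last first.
  (* Copies already touched in [H]. A played hub contributes the default index 0, which is harmless: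
     at most three entries cannot exhaust more than three copies. *)
  pose used := [seq (if p.2 is Some q then q.1 else Ordinal (ltn_trans (isT : 0 < 3) n4)) | p : G * H <- ps].
  have [j hj] : exists j, j \notin used.
    apply/existsP; rewrite -negb_forall; apply/negP=> /forallP all_used.
    have: #|'I_n| <= size used.
      apply: leq_trans (card_size used).
      by apply: subset_leq_card; apply/subsetP=> j _; apply: all_used.
    by rewrite card_ord size_map leqNgt (leq_ltn_trans sz n4).
  pose k0 : 'I_m2 := Ordinal (ltn_trans (isT : 0 < 2) m2_ge3).
  exists (Some (j, k0)); apply: strictI => // -[p q] hp /=.
  have pne : p != Some (i, k) := new _ hp.
  have qj : (if q is Some q' then q'.1 == j else false) = false.
    case: q hp => [[j' k']|] // hp /=; apply: contraNF hj => /eqP <-.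
    by apply/mapP; exists (p, Some (j', k')).
  have qne : q != Some (j, k0) by apply: contraFneq qj => -> /=.
  rewrite (negPf pne) (negPf qne); split=> //.
  have := newcl _ hp; have := hub _ hp => /=; rewrite !adjE //=.
  by case: p q qj {hp pne qne} => [p|] [q|] //= -> _ /negPf->.
case: p0 hp0 cl0 => [[i0 k0]|] //= hp0 /eqP e; subst i0.
case: q0 hp0 => [[j l0]|] hp0; last by have := hub _ hp0.
(* Copies [i] and [j] correspond through the pair already played in them. *)
have sameclass p q : (p, q) \in ps ->
    (if p is Some p' then p'.1 == i else true) = (if q is Some q' then q'.1 == j else true).
  move=> hp; have [/= e1 e2] := iso _ _ hp hp0.
  have := hub _ hp => /= e3.
  have [e|ne] := eqVneq p (Some (i, k0)).
    move: e1; rewrite e eqxx => /esym/eqP->; by rewrite !eqxx.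
  by rewrite -!(adjE _ _ _ k0, adjE _ _ _ l0) // -e1.
have [/existsP[l hl]|/existsPn full] :=
    boolP [exists l, Some (j, l) \notin [seq p.2 | p <- ps]].
  exists (Some (j, l)); apply: strictI => // -[p q] hp /=.
  have pne : p != Some (i, k) := new _ hp.
  have qne : q != Some (j, l).
    by apply: contraNneq hl => <-; apply/mapP; exists (p, q).
  by rewrite (negPf pne) (negPf qne) !adjE // (sameclass _ _ hp).
have sub : {subset [seq Some (j, l) | l : 'I_m2] <= [seq p.2 | p <- ps]}.
  by move=> _ /mapP[l _ ->]; apply/negPn/full.
have uj : uniq [seq Some (j, l) | l : 'I_m2].
  by rewrite map_inj_uniq ?enum_uniq // => l l' [].
have szj : size [seq Some (j, l) | l : 'I_m2] = m2 by rewrite size_map -cardE card_ord.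
have le2 := uniq_leq_size uj sub; rewrite szj size_map in le2.
(* All [m2 >= 3] vertices of copy [j] are among at most three answers, so these answers are exactly
   copy [j] and the hub is still free. *)
have [_ eqj] := uniq_min_size uj sub (leq_trans (eq_leq (size_map _ _)) (leq_trans sz (leq_trans m2_ge3 (eq_leq (esym szj))))).
exists None; split; last by move=> h; have := leq_trans le2 h; rewrite leqNgt m2_ge3.
apply: consI => -[p q] hp /=.
have pne : p != Some (i, k) := new _ hp.
have /mapP[l _ ql] : q \in [seq Some (j, l) | l : 'I_m2].
  by rewrite eqj; apply/mapP; exists (p, q).
by rewrite (negPf pne) adjE // (sameclass _ _ hp) ql /= eqxx.
Qed.

End Windmills.

Lemma partial_iso_swap (G H : graph) (ps : seq (G * H)) :
  partial_iso ps -> partial_iso [seq (p.2, p.1) | p <- ps].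
Proof.
by move=> iso _ _ /mapP[p hp ->] /mapP[q hq ->]; have [] := iso p q hp hq.
Qed.

Lemma hub_iso_swap n m1 m2 (ps : seq (windmill n m1 * windmill n m2)) :
  hub_iso ps -> hub_iso [seq (p.2, p.1) | p <- ps].
Proof.
move=> [iso hub]; split; first exact: partial_iso_swap.
by move=> _ /mapP[p hp ->]; rewrite /= hub.
Qed.

Lemma windmill_duplicator_wins n m1 m2 r (ps : seq (windmill n m1 * windmill n m2)) :
  3 < n -> 2 < m1 -> 2 < m2 -> size ps + r <= 4 -> hub_iso ps -> duplicator_wins r ps.
Proof.
move=> n4 m1_ge3 m2_ge3; elim: r ps => [|r IH] ps sz iso; first by case: iso.
have sz3 : size ps <= 3 by rewrite -ltnS (leq_trans _ sz) // addnS ltnS leq_addr.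
(* If a round remains after this one, at most two pairs were on the board and [hub_iso] survives;
   after the last round [partial_iso] suffices. *)
have next p : partial_iso (p :: ps) -> (size ps <= 2 -> hub_iso (p :: ps)) ->
    duplicator_wins r (p :: ps).
  case: r IH sz => [//|r] IH sz _ hub; apply: IH; first by rewrite /= addSnnS.
  by apply: hub; rewrite -2!ltnS (leq_trans _ sz) // !addnS !ltnS leq_addr.
split=> [x|y].
  by have [y [h1 h2]] := windmill_forth n4 m2_ge3 x sz3 iso; exists y; apply: next.
have sz3' : size [seq (p.2, p.1) | p <- ps] <= 3 by rewrite size_map.
have [x [h1 h2]] := windmill_forth n4 m1_ge3 y sz3' (hub_iso_swap iso).
have swapK : [seq (p.2, p.1) | p <- [seq (p.2, p.1) | p <- ps]] = ps.
  by rewrite -map_comp -[RHS]map_id; apply: eq_map; case.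
exists x; apply: next => [|sz2]; rewrite -swapK.
  exact: partial_iso_swap h1.
by apply: (hub_iso_swap (ps := (y, x) :: _)); apply: h2; rewrite size_map.
Qed.

(** * The value of D_v for S_{4,4} *)

Theorem theorem2 :
  (exists F : graph, connected F /\
     exists d, Dv_is F d /\ d <= nverts F - 3) /\
  Dv_is (sparkler 4 4) 5.
Proof.
suff dv : Dv_is S44 5.
  split=> //; exists S44; split; first exact: sparkler44_connected.
  by exists 5; split=> //; rewrite /nverts card_ord.
split; first exact: sparkler44_definable.
move=> d d5 [phi [k [sent [qd def]]]].
(* With [k + 4] copies both windmills have at least [k] vertices and more than three copies. *)
have n4 : 3 < k + 4 by rewrite addnS ltnS leq_addl.
have big m : 0 < m -> k <= nverts (windmill (k + 4) m).
  move=> m0; rewrite windmill_nverts; apply: leqW.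
  by apply: leq_trans (leq_pmulr _ m0); apply: leq_addr.
apply: (@windmill3_not_contains (k + 4)).
apply/(def _ (windmill_connected _ _) (big 3 isT)) => t.
have /(def _ (windmill_connected _ _) (big 4 isT)) mod4 := windmill4_contains n4.
rewrite -(@duplicator_wins_holds (windmill (k + 4) 4) _ 4 [::] phi (fun=> None) t).
- exact: mod4.
- by apply/card_gt0P; exists None.
- by apply: windmill_duplicator_wins.
- exact: leq_trans qd d5.
- by move: sent; rewrite /sentence => /nilP->.
Qed.
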